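(* Let $W\ge 1$ and $L\ge 0$ be integers and let $p$ be the number of parameters defining $\mathrm{NNF}_{W,L}^{1\to 1}$. If $\ell$ is an integer with $\ell>p$, then not all CPwL functions with $\ell$ knots are contained in $\mathrm{NNF}_{W,L}^{1\to 1}$.
   Context: All functions are considered on a fixed compact interval $\mathcal{K}=[a,b]\subset\mathbb{R}$ with $a<b$. Neural network functions: $\mathrm{ReLU}$ acts on a vector coordinatewise by $t\mapsto\max(t,0)$. A neural network function (NNF) is a function of the form $f(x)=\eta_1\circ\eta_2\circ\cdots\circ\eta_{2q+1}(x)$ for $x\in\mathcal{K}$, where $\eta_{2i-1}$ is an affine transformation for every $i=1,\ldots,q+1$ and $\eta_{2i}=\mathrm{ReLU}$ for every $i=1,\ldots,q$. The depth of such a representation is $q$, and its width is the maximal input or output dimension of all the $\eta_i$. $\mathrm{NNF}_{w,q}^{1\to 1}$ is the family of functions $f:\mathcal{K}\to\mathbb{R}$ having such a representation with depth at most $q$ and width at most $w$. Number of parameters: the parameters defining $\mathrm{NNF}_{W,L}^{1\to 1}$ are all entries of the matrices and translation vectors of the affine transformations in the fully connected architecture of depth $L$ all of whose hidden layers have dimension $W$; that is, $p=2W+(L-1)(W^2+W)+(W+1)$ if $L\ge 1$, and $p=2$ if $L=0$. CPwL functions with $\ell$ knots: a continuous function $g:\mathcal{K}\to\mathbb{R}$ is a continuous piecewise linear (CPwL) function with $\ell$ knots if there are points $t_1<\cdots<t_\ell$ in $(a,b)$ (the knots) such that $g$ is affine on each of the intervals $[a,t_1],[t_1,t_2],\ldots,[t_{\ell-1},t_\ell],[t_\ell,b]$.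 *)

(* Defs.v *)
From HB Require Import structures.
From mathcomp Require Import all_boot all_order all_algebra.
From mathcomp Require Import all_classical all_reals all_analysis.
From mathcomp Require Import ring zify.

Set Implicit Arguments.
Unset Strict Implicit.
Unset Printing Implicit Defensive.

Import Order.TTheory GRing.Theory Num.Theory.
Import numFieldNormedType.Exports.

Local Open Scope classical_set_scope.
Local Open Scope ring_scope.

Definition relu (R : realType) (t : R) : R := Num.max t 0.

(* A network from R^m to R^n: an affine map v |-> A v + c (the output layer),
   or such a map into a hidden layer R^k, then ReLU, then a network from R^k.
   Thus the outermost constructor is the map applied first.
   A hidden layer R^0 is allowed; it only yields constant functions. *)
Inductive network (R : realType) (m n : nat) : Type :=
| Output of 'M[R]_(n, m) & 'cV[R]_n
| Hidden k of 'M[R]_(k, m) & 'cV[R]_k & network R k n.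

Fixpoint network_eval (R : realType) (m n : nat) (N : network R m n) :
    'cV[R]_m -> 'cV[R]_n :=
  match N with
  | Output A c => fun v => A *m v + c
  | Hidden k A c N' => fun v => network_eval N' (map_mx (@relu R) (A *m v + c))
  end.

Fixpoint depth (R : realType) (m n : nat) (N : network R m n) : nat :=
  match N with
  | Output _ _ => 0
  | Hidden _ _ _ N' => (depth N').+1
  end.

Fixpoint width (R : realType) (m n : nat) (N : network R m n) : nat :=
  match N with
  | Output _ _ => maxn m n
  | Hidden k _ _ N' => maxn m (width N')
  end.

(* Functions on [a, b] are represented by functions on R of which only the
   values on [a, b] matter. *)
Definition NNF (R : realType) (a b : R) (w q : nat) : set (R -> R) :=
  [set f | exists N : network R 1 1,
     [/\ (depth N <= q)%N, (width N <= w)%N &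
         {in `[a, b], forall x, f x = network_eval N (const_mx x) ord0 ord0}]].

(* Number of matrix and translation entries of the affine maps of a fully
   connected architecture with input dimension d and subsequent layer
   dimensions ds. *)
Fixpoint arch_params (d : nat) (ds : seq nat) : nat :=
  if ds is d' :: ds' then (d' * d + d' + arch_params d' ds')%N else 0%N.

Definition num_params (W L : nat) : nat :=
  arch_params 1 (rcons (nseq L W) 1%N).

Lemma num_paramsE (W L : nat) :
  num_params W L =
    (if L is L'.+1 then 2 * W + L' * (W ^ 2 + W) + (W + 1) else 2)%N.
Proof.
case: L => [//|L]; rewrite /num_params /= muln1.
have -> : arch_params W (rcons (nseq L W) 1%N) = (L * (W ^ 2 + W) + (W + 1))%N.
  by elim: L => [|L IH] /=; [lia | rewrite IH; nia].
by lia.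
Qed.

Definition affine_on (R : realType) (u v : R) (g : R -> R) : Prop :=
  exists c d : R, {in `[u, v], forall x, g x = c * x + d}.

Definition CPwL (R : realType) (a b : R) (l : nat) : set (R -> R) :=
  [set g | {within `[a, b], continuous g} /\
     exists t : l.-tuple R,
       [/\ sorted <%R t, all (fun x => a < x < b) t &
           forall i, (i <= l)%N ->
             let s := a :: rcons t b in affine_on s`_i s`_i.+1 g]].

(* Main.v *)
(* ReLU maps every subring of [R] to itself, so a network with parameters [th]
   takes values in the ring [Q[th]] at rational points. For rational knots
   [t_0 < t_1 < ...], the coefficients of [sum_j y_j relu(x - t_j)] are
   successively recovered, over the rationals, from the values of this function
   at [t_1, ..., t_l], where [t_l < b] is one more rational point. If it is a
   network function, then all [y_j] lie in [Q[th]], which is impossible when the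
   [y_j] are algebraically independent over [Q] and outnumber the parameters. *)

From HB Require Import structures.
Require Import Defs.
From mathcomp Require Import all_boot all_order all_algebra.
From mathcomp Require Import all_classical all_reals all_analysis.
From mathcomp Require Import ring zify.

Set Implicit Arguments.
Unset Strict Implicit.
Unset Printing Implicit Defensive.

Import Order.TTheory GRing.Theory Num.Theory.
Import numFieldNormedType.Exports.

Local Open Scope classical_set_scope.
Local Open Scope ring_scope.

(** * Values of rational polynomials and the ring they form *)

(* [c] lists the coefficients of a rational polynomial of degree at most [D] in
   each variable. *)
Definition rat_eval {R : numFieldType} {I : finType} (th : I -> R) {D : nat}
    (c : {ffun {ffun I -> 'I_D.+1} -> rat}) : R :=
  \sum_e ratr (c e) * \prod_i th i ^+ e i.

(** Capping every exponent at [D] leaves a rational vector space spanned by [(D + 1) ^ #|I|]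
    monomials; dimension counts need this finiteness. *)
Definition rat_poly_values {R : numFieldType} {I : finType} (th : I -> R)
    (D : nat) : set R := range (rat_eval th (D := D)).

Definition alg_independent {R : numFieldType} {I : finType} (y : I -> R) :=
  forall D (c : {ffun {ffun I -> 'I_D.+1} -> rat}), rat_eval y c = 0 -> c = 0.

Section RationalPolynomialValues.
Context {R : numFieldType} {I : finType} (th : I -> R).

Lemma rat_poly_values0 D : rat_poly_values th D 0.
Proof.
exists 0 => //; rewrite /rat_eval big1 // => e _.
by rewrite ffunE rmorph0 mul0r.
Qed.

Lemma rat_poly_valuesD D x y :
  rat_poly_values th D x -> rat_poly_values th D y -> rat_poly_values th D (x + y).
Proof.
move=> [c _ <-] [d _ <-]; exists (c + d) => //.
by rewrite /rat_eval -big_split; apply: eq_bigr => e _; rewrite ffunE rmorphD mulrDl.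
Qed.

Lemma rat_poly_valuesZ D q x :
  rat_poly_values th D x -> rat_poly_values th D (ratr q * x).
Proof.
move=> [c _ <-]; exists [ffun e => q * c e] => //.
by rewrite /rat_eval mulr_sumr; apply: eq_bigr => e _; rewrite ffunE rmorphM mulrA.
Qed.

Lemma rat_poly_values_sum D (J : Type) (r : seq J) (F : J -> R) :
  (forall j, rat_poly_values th D (F j)) ->
  rat_poly_values th D (\sum_(j <- r) F j).
Proof.
move=> FD; elim/big_ind: _ => //; first exact: rat_poly_values0.
exact: rat_poly_valuesD.
Qed.

Lemma rat_poly_values_monomial D (f : I -> nat) :
  (forall i, f i <= D)%N -> rat_poly_values th D (\prod_i th i ^+ f i).
Proof.
move=> fD; pose e := [ffun i => inord (f i) : 'I_D.+1].
exists [ffun e' => (e' == e)%:R] => //.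
rewrite /rat_eval (bigD1 e) //= [X in _ + X]big1 ?addr0 => [|e' /negPf e'e].
  rewrite ffunE eqxx rmorph1 mul1r.
  by apply: eq_bigr => i _; rewrite ffunE inordK // ltnS.
by rewrite ffunE e'e rmorph0 mul0r.
Qed.

Lemma rat_poly_valuesM D E x y :
  rat_poly_values th D x -> rat_poly_values th E y ->
  rat_poly_values th (D + E) (x * y).
Proof.
move=> [c _ <-] [d _ <-]; rewrite {1}/rat_eval mulr_suml.
apply: rat_poly_values_sum => e; rewrite /rat_eval mulr_sumr.
apply: rat_poly_values_sum => e'.
rewrite mulrACA -mulrA; do 2 apply: rat_poly_valuesZ.
rewrite -big_split /=; under eq_bigr => i _ do rewrite -exprD.
by apply: rat_poly_values_monomial => i; rewrite leq_add // -ltnS.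
Qed.

Lemma rat_poly_values_leq D E x :
  (D <= E)%N -> rat_poly_values th D x -> rat_poly_values th E x.
Proof.
move=> DE [c _ <-]; apply: rat_poly_values_sum => e.
apply/rat_poly_valuesZ/rat_poly_values_monomial => i.
by rewrite (leq_trans _ DE) // -ltnS.
Qed.

Lemma rat_poly_values_rat q : rat_poly_values th 0 (ratr q).
Proof.
rewrite -[ratr q]mulr1; apply: rat_poly_valuesZ.
rewrite -(_ : \prod_i th i ^+ 0%N = 1); first exact: rat_poly_values_monomial.
by rewrite big1 // => i _; rewrite expr0.
Qed.

Lemma rat_poly_valuesX D k x :
  rat_poly_values th D x -> rat_poly_values th (k * D) (x ^+ k).
Proof.
move=> xD; elim: k => [|k IH]; last by rewrite exprS mulSn; apply: rat_poly_valuesM.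
by rewrite expr0 -(rmorph1 (ratr : rat -> R)); apply: rat_poly_values_rat.
Qed.

Lemma rat_poly_values_prod D (J : Type) (r : seq J) (F : J -> R) :
  (forall j, rat_poly_values th D (F j)) ->
  rat_poly_values th (size r * D) (\prod_(j <- r) F j).
Proof.
move=> FD; elim: r => [|j r IH]; last first.
  by rewrite big_cons mulSn; apply: rat_poly_valuesM.
by rewrite big_nil -(rmorph1 (ratr : rat -> R)); apply: rat_poly_values_rat.
Qed.

(** The ring generated over the rationals by the [th i], as the increasing union of the spaces
    [rat_poly_values th D]. *)
Definition rat_adjoin : {pred R} :=
  [pred x | `[< exists D, rat_poly_values th D x >]].

Lemma rat_adjoinP x : reflect (exists D, rat_poly_values th D x) (x \in rat_adjoin).
Proof. exact: asboolP. Qed.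

Lemma rat_adjoin_rat q : ratr q \in rat_adjoin.
Proof. by apply/rat_adjoinP; exists 0%N; apply: rat_poly_values_rat. Qed.

Lemma rat_adjoin_gen i : th i \in rat_adjoin.
Proof.
apply/rat_adjoinP; exists 1%N.
rewrite -(_ : \prod_j th j ^+ (j == i) = th i).
  by apply: rat_poly_values_monomial => j; rewrite leq_b1.
rewrite (bigD1 i) //= eqxx expr1 big1 ?mulr1 // => j /negPf ->.
by rewrite expr0.
Qed.

Lemma rat_adjoin_subring_closed : subring_closed rat_adjoin.
Proof.
split=> [|x y /rat_adjoinP[D xD] /rat_adjoinP[E yE]
          |x y /rat_adjoinP[D xD] /rat_adjoinP[E yE]].
- by rewrite -(rmorph1 (ratr : rat -> R)) rat_adjoin_rat.
- apply/rat_adjoinP; exists (maxn D E); apply: rat_poly_valuesD.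
    exact: rat_poly_values_leq (leq_maxl _ _) xD.
  rewrite -mulN1r -(rmorphN1 (ratr : rat -> R)); apply: rat_poly_valuesZ.
  exact: rat_poly_values_leq (leq_maxr _ _) yE.
- by apply/rat_adjoinP; exists (D + E)%N; apply: rat_poly_valuesM.
Qed.

HB.instance Definition _ :=
  GRing.isSubringClosed.Build R rat_adjoin rat_adjoin_subring_closed.

End RationalPolynomialValues.

(** * Algebraically independent families: bound on their size *)

(** A rational matrix with more rows than columns has a nonzero left kernel. *)
Lemma rat_dependent (I J : finType) (C : I -> J -> rat) :
  (#|J| < #|I|)%N ->
  exists2 r : {ffun I -> rat}, r != 0 & forall j, \sum_i r i * C i j = 0.
Proof.
move=> JI; pose M := \matrix_(i < #|I|, j < #|J|) C (enum_val i) (enum_val j).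
have : kermx M != 0.
  rewrite kermx_eq0 /row_free neq_ltn (leq_ltn_trans (rank_leq_col M)) //.
case/rowV0Pn => v /sub_kermxP vM v0.
exists [ffun i => v 0 (enum_rank i)].
  apply: contraNneq v0 => /ffunP r0; apply/eqP/rowP => i.
  by have := r0 (enum_val i); rewrite !ffunE enum_valK mxE.
move=> j; transitivity ((v *m M) 0 (enum_rank j)); last by rewrite vM mxE.
rewrite mxE.
rewrite (reindex _ (onW_bij _ (enum_val_bij I))) /=; apply: eq_bigr => i _.
by rewrite ffunE enum_valK mxE enum_rankK.
Qed.

(* The [(N + 1)^l] monomials in [y] of degree at most [N] in each variable lie
   in the span of the [(l N D + 1)^p] monomials in [th] of degree at most
   [l N D] in each variable, and the former number wins for large [N]. *)
Lemma alg_independent_leq (R : numFieldType) (p l : nat) (th : 'I_p -> R)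
    (y : 'I_l -> R) :
  alg_independent y -> (forall j, y j \in rat_adjoin th) -> (l <= p)%N.
Proof.
move=> yind yth; rewrite leqNgt; apply/negP => pl.
have [D yD] : exists D, forall j, rat_poly_values th D (y j).
  have /fin_all_exists [d yd] : forall j, exists D, rat_poly_values th D (y j).
    by move=> j; apply/rat_adjoinP.
  exists (\max_j d j) => j; apply: rat_poly_values_leq (yd j).
  exact: leq_bigmax.
(* Since [E + 1 <= (N + 1) K] and [K ^ p = N], one gets [(E + 1) ^ p <= (N + 1) ^ p N < (N + 1) ^ (p
   + 1) <= (N + 1) ^ l]. *)
pose K := (l * D).+1; pose N := (K ^ p)%N; pose E := (l * (N * D))%N.
have /fin_all_exists [C yC] (e : {ffun 'I_l -> 'I_N.+1}) :
    exists c : {ffun {ffun 'I_p -> 'I_E.+1} -> rat},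
      rat_eval th c = \prod_j y j ^+ e j.
  have [c _ ?] : rat_poly_values th E (\prod_j y j ^+ e j); last by exists c.
  rewrite /E -[X in (X * _)%N]size_enum_ord.
  rewrite -big_enum.
  apply: rat_poly_values_prod => j.
  apply: rat_poly_values_leq (rat_poly_valuesX _ (yD j)).
  by rewrite leq_mul2r -ltnS ltn_ord orbT.
have [|r r0 rC] := @rat_dependent _ _ (fun e f => C e f).
  rewrite !card_ffun !card_ord.
  have leX m n k : (m <= n -> m ^ k <= n ^ k)%N.
    by move=> mn; elim: k => // k IH; rewrite !expnS leq_mul.
  have EK : (E.+1 <= N.+1 * K)%N by rewrite /E /K; nia.
  apply: leq_ltn_trans (_ : (N.+1 ^ p * N < _)%N).
    by rewrite /N -expnMn; apply: leX.
  apply: leq_trans (_ : N.+1 ^ p.+1 <= _)%N; last first.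
    by rewrite leq_exp2l ?ltnS ?expn_gt0.
  by rewrite expnSr ltn_mul2l expn_gt0 /= ltnS.
(* The relation [r] between the coefficient vectors of the monomials in [y] is itself a rational
   polynomial vanishing at [y]. *)
case/eqP: r0; apply: yind.
rewrite /rat_eval; under eq_bigr => e _ do rewrite -yC /rat_eval mulr_sumr.
rewrite exchange_big big1 //= => f _.
under eq_bigr => e _ do rewrite mulrA -rmorphM.
by rewrite -mulr_suml -rmorph_sum rC rmorph0 mul0r.
Qed.

(** * Existence of algebraically independent reals *)

Lemma countable_roots (R : realType) (p : {poly R}) :
  p != 0 -> countable [set x | root p x].
Proof.
move=> p0; apply: finite_set_countable; apply: contrapT => inf_roots.
have [B Bp] := infinite_set_fset (size p) inf_roots.
rewrite leqNgt (max_poly_roots p0) ?finmap.fset_uniq //.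
by apply/allP => x xB; apply: Bp.
Qed.

(** A countable set has Lebesgue measure 0, while the line has infinite measure. *)
Lemma exists_notin_countable (R : realType) (A : set R) :
  countable A -> exists x, ~ A x.
Proof.
move=> cA; apply/not_existsP => AT.
have := @countable_lebesgue_measure0 R A cA.
have -> : A = [set` (`]-oo, +oo[)%R].
  by apply/seteqP; split => // x _; apply: contrapT.
by rewrite lebesgue_measure_itv.
Qed.

(** Induction on [l]: there are countably many nonzero rational polynomials in [l + 1] variables.
    Substituting [y] for all variables but one leaves nonzero polynomials in one variable, whose
    roots form a countable set; any [z] outside it extends [y]. *)
Lemma exists_alg_independent (R : realType) l :
  exists y : 'I_l -> R, alg_independent y.
Proof.
elim: l => [|l [y yind]].
  (* Without variables there is one exponent vector, and its monomial is the empty product 1. *)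
  exists (fun=> 0) => D c; rewrite /rat_eval => c0.
  apply/ffunP => e; rewrite ffunE; move: c0.
  rewrite (big_pred1 e) ?big_ord0 ?mulr1 => [/eqP|e' /=].
    by rewrite fmorph_eq0 => /eqP.
  by apply/esym/eqP/ffunP => -[].
(* Index 0 is reserved for the new variable; [lift ord0] shifts the old ones. *)
pose cons D (k : 'I_D.+1) (e : {ffun 'I_l -> 'I_D.+1}) :
  {ffun 'I_l.+1 -> 'I_D.+1} := [ffun i => oapp e k (unlift ord0 i)].
pose tail D (f : {ffun 'I_l.+1 -> 'I_D.+1}) : {ffun 'I_l -> 'I_D.+1} :=
    [ffun i => f (lift ord0 i)].
have consK D (f : {ffun 'I_l.+1 -> 'I_D.+1}) : cons D (f ord0) (tail D f) = f.
  apply/ffunP => i; rewrite ffunE.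
  by case: unliftP => [j|] -> //=; rewrite ffunE.
(* [c] read as a polynomial in variable 0, with its coefficients evaluated at [y]; independence of
   [y] keeps it nonzero. *)
pose P D (c : {ffun {ffun 'I_l.+1 -> 'I_D.+1} -> rat}) :=
  \poly_(k < D.+1) rat_eval y [ffun e => c (cons D (inord k) e)].
have P_neq0 D (c : {ffun {ffun 'I_l.+1 -> 'I_D.+1} -> rat}) : c != 0 -> P D c != 0.
  apply: contraNneq => Pc0; apply/eqP/ffunP => f; rewrite ffunE.
  have := congr1 (fun p : {poly R} => p`_(f ord0)) Pc0.
  rewrite coef_poly ltn_ord coef0 => /yind /ffunP /(_ (tail D f)).
  by rewrite !ffunE inord_val consK.
have [|z zP] := @exists_notin_countable R
  (\bigcup_D \bigcup_(c in [set c | c != 0]) [set z | root (P D c) z]).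
  do 2 (apply: bigcup_countable => [|? ?]; first exact: countableP).
  exact/countable_roots/P_neq0.
exists (fun i => oapp y z (unlift ord0 i)) => D c.
apply: contra_eq => c0; apply: contra_notN zP => /eqP cz.
exists D => //; exists c => //=; apply/eqP; rewrite -cz horner_poly.
rewrite [RHS]/rat_eval.
rewrite (reindex (fun ke => cons D ke.1 ke.2)) /=; last first.
  exists (fun f : {ffun 'I_l.+1 -> 'I_D.+1} => (f ord0, tail D f))
    => [[k e] _|f _] //=.
  rewrite ffunE unlift_none; congr pair.
  by apply/ffunP => i; rewrite !ffunE liftK.
rewrite -(pair_bigA _ (fun k e => ratr (c (cons D k e)) *
  \prod_i oapp y z (unlift ord0 i) ^+ cons D k e i)) /=.
apply: eq_bigr => k _; rewrite mulr_suml; apply: eq_bigr => e _.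
rewrite !ffunE inord_val -mulrA; congr (_ * _).
rewrite big_ord_recl unlift_none ffunE unlift_none mulrC; congr (_ * _).
by apply: eq_bigr => i _; rewrite liftK ffunE liftK.
Qed.

(** * Parameters of a network and the ring containing its values *)

Definition affine_entries (R : Type) (m n : nat) (A : 'M[R]_(n, m))
    (c : 'cV[R]_n) : seq R :=
  [seq A i j | i <- enum 'I_n, j <- enum 'I_m] ++ [seq c i ord0 | i <- enum 'I_n].

Fixpoint network_entries (R : realType) (m n : nat) (N : network R m n) : seq R :=
  match N with
  | Output A c => affine_entries A c
  | Hidden k A c N' => affine_entries A c ++ network_entries N'
  end.

Lemma size_affine_entries (R : Type) (m n : nat) (A : 'M[R]_(n, m)) (c : 'cV[R]_n) :
  size (affine_entries A c) = (n * m + n)%N.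
Proof. by rewrite size_cat size_allpairs size_map !size_enum_ord. Qed.

Lemma arch_params_leq (d d' : nat) (ds : seq nat) :
  (d <= d')%N -> (arch_params d ds <= arch_params d' ds)%N.
Proof. by case: ds => //= e ds dd'; rewrite !leq_add2r leq_mul2l dd' orbT. Qed.

Lemma leq_width (R : realType) (m n : nat) (N : network R m n) : (m <= width N)%N.
Proof. by case: N => [A c|k A c N] /=; rewrite leq_maxl. Qed.

(** Layer by layer, each affine map is at most as large as its counterpart in the full
    architecture. *)
Lemma size_network_entries (R : realType) (m n : nat) (N : network R m n)
    (W L : nat) :
  (depth N <= L)%N -> (width N <= W)%N ->
  (size (network_entries N) <= arch_params m (rcons (nseq L W) n))%N.
Proof.
elim: N L => [{}m {}n A c|{}m {}n k A c N IH] [|L] //=.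
- by rewrite size_affine_entries addn0.
(* The network ends early: its output map is compared with a map into a hidden layer of dimension
   [W >= n]. *)
- rewrite geq_max size_affine_entries => _ /andP[mW nW].
  rewrite -[leqLHS]addn0 leq_add //.
  by rewrite leq_add // leq_mul2r nW orbT.
- rewrite ltnS geq_max size_cat size_affine_entries => NL /andP[mW NW].
  have kW : (k <= W)%N := leq_trans (leq_width N) NW.
  rewrite leq_add ?(leq_add _ kW) ?leq_mul2r ?kW ?orbT //.
  exact: leq_trans (IH _ NL NW) (arch_params_leq _ kW).
Qed.

Lemma affine_rpred (R : realType) (S : subringClosed R) (m n : nat)
    (A : 'M[R]_(n, m)) (c : 'cV[R]_n) (v : 'cV[R]_m) :
  {subset affine_entries A c <= S} -> (forall j, v j ord0 \in S) ->
  forall i, (A *m v + c) i ord0 \in S.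
Proof.
move=> AcS vS i; rewrite !mxE rpredD //; last first.
  by apply: AcS; rewrite mem_cat orbC (map_f (fun i => c i ord0)) ?mem_enum.
apply: rpred_sum => j _; rewrite rpredM // AcS // mem_cat.
by rewrite (allpairs_f (fun i j => A i j)) ?mem_enum.
Qed.

(** Affine maps with entries in [S] preserve [S], and ReLU returns either its argument or 0. *)
Lemma network_eval_rpred (R : realType) (S : subringClosed R) (m n : nat)
    (N : network R m n) (v : 'cV[R]_m) :
  {subset network_entries N <= S} -> (forall j, v j ord0 \in S) ->
  forall i, network_eval N v i ord0 \in S.
Proof.
elim: N v => [{}m {}n A c|{}m {}n k A c N IH] v /= NS vS; first exact: affine_rpred.
apply: IH => [x xN|j]; first by apply: NS; rewrite mem_cat xN orbT.
rewrite mxE /relu maxEle; case: ifP => _; first exact: rpred0.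
by apply: affine_rpred => // x xA; apply: NS; rewrite mem_cat xA.
Qed.

(** * Sums of ramps: piecewise linearity and recovery of coefficients *)

Lemma affine_on_sum (R : realType) (u v : R) (J : finType) (F : J -> R -> R) :
  (forall j, affine_on u v (F j)) -> affine_on u v (fun x => \sum_j F j x).
Proof.
move=> /fin_all_exists [c] /fin_all_exists [d] Fcd.
exists (\sum_j c j), (\sum_j d j) => x xuv.
by rewrite mulr_suml -big_split; apply: eq_bigr => j _; apply: Fcd.
Qed.

Lemma affine_on_ramp (R : realType) (u v y t : R) :
  v <= t \/ t <= u -> affine_on u v (fun x => y * relu (x - t)).
Proof.
case=> [vt|tu]; [exists 0, 0|exists y, (- y * t)] => x;
  rewrite in_itv /= => /andP[ux xv].
  by rewrite /relu max_r ?subr_le0 ?(le_trans xv) // mulr0 mul0r addr0.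
by rewrite /relu max_l ?subr_ge0 ?(le_trans tu) //; ring.
Qed.

Lemma ramp_sum_CPwL (R : realType) (a b : R) (l : nat) (t : nat -> R)
    (y : 'I_l -> R) :
  {homo t : i j / (i < j)%N >-> i < j} ->
  (forall i, (i < l)%N -> a < t i < b) ->
  CPwL a b l (fun x => \sum_j y j * relu (x - t j)).
Proof.
move=> t_incr t_ab; split.
  apply: continuous_subspaceT; apply: continuous_big => [|j _].
    exact: add_continuous.
  move=> x; apply: cvgMr.
  apply: (@continuous_max R R (fun x => x - t j) (cst 0)); last exact: cvg_cst.
  by apply: cvgB => //; exact: cvg_cst.
have size_t : size (mkseq t l) == l by rewrite size_mkseq.
exists (Tuple size_t); split => /=.
- exact: homo_sorted (iota_ltn_sorted 0 l).
- by apply/allP => _ /mapP[i + ->]; rewrite mem_iota => /t_ab.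
have t_mono : {mono t : i j / (i <= j)%N >-> i <= j}.
  by apply: le_mono => i j; apply: t_incr.
move=> i il; apply: affine_on_sum => j; apply: affine_on_ramp.
(* Prepending [a] shifts indices: piece [i] ends at [t i] (at [b] if [i = l]) and, for [i > 0],
   starts at [t (i - 1)]. Ramps with [j >= i] still vanish on it; those with [j < i] have already
   started. *)
rewrite nth_rcons size_mkseq.
have [ij|ji] := leqP i j; [left|right].
  by rewrite (leq_ltn_trans ij) // nth_mkseq ?(leq_ltn_trans ij) // t_mono.
case: i il ji => // i il ji.
by rewrite /= nth_rcons size_mkseq il nth_mkseq // t_mono.
Qed.

(** The system is triangular: at [u (j + 1)] the ramps after the [j]-th vanish, those before it have
    coefficients known by strong induction, and [y j] appears with a nonzero rational factor. The
    last coefficient is read off at [u l], a point beyond all knots. *)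
Lemma ramp_coef_rat_adjoin (R : realType) (p l : nat) (th : 'I_p -> R)
    (u : nat -> rat) (y : 'I_l -> R) :
  {homo u : i j / (i < j)%N >-> i < j} ->
  (forall k, (k <= l)%N ->
     \sum_(j < l) y j * relu (ratr (u k) - ratr (u j)) \in rat_adjoin th) ->
  forall j, y j \in rat_adjoin th.
Proof.
move=> u_incr gS j; have [k] := ubnP (j : nat).
elim: k => // k IH in j *; rewrite ltnS => jk.
have /= := gS j.+1 (ltn_ord j); rewrite (bigD1 j) //=.
have uj : 0 < u j.+1 - u j by rewrite subr_gt0 u_incr.
have -> : relu (ratr (u j.+1) - ratr (u j)) = ratr (u j.+1 - u j) :> R.
  by rewrite rmorphB /= /relu max_l // -rmorphB /= ler0q ltW.
rewrite rpredDr => [yS|]; last first.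
  apply: rpred_sum => i; rewrite neq_ltn => /orP[ij|ji].
    rewrite rpredM ?IH ?(leq_trans ij) //.
    rewrite /relu -rmorphB maxEle; case: ifP => _ /=; first exact: rpred0.
    exact: rat_adjoin_rat.
  rewrite /relu max_r ?mulr0 ?rpred0 // subr_le0 ler_rat.
  by move: ji; rewrite leq_eqVlt => /predU1P[->//|/u_incr/ltW].
have -> : y j = y j * ratr (u j.+1 - u j) * ratr (u j.+1 - u j)^-1.
  by rewrite fmorphV mulfK // fmorph_eq0 gt_eqF.
by rewrite rpredM // rat_adjoin_rat.
Qed.

(** An arithmetic progression with rational start [q] between [a] and [b] and positive rational step
    below [(b - q) / (l + 1)]. Its [l + 1] points serve as [l] knots and one extra evaluation
    point. *)
Lemma rat_progression_itvoo (R : realType) (a b : R) (l : nat) :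
  a < b -> exists2 u : nat -> rat, {homo u : i j / (i < j)%N >-> i < j} &
    forall k, (k <= l)%N -> a < ratr (u k) < b.
Proof.
move=> ab; have [q] := rat_in_itvoo ab; rewrite in_itv => /andP[/= aq qb].
have : 0 < (b - ratr q) / l.+1%:R by rewrite divr_gt0 ?subr_gt0.
case/rat_in_itvoo => e; rewrite in_itv /= => /andP[e0].
rewrite ltr_pdivlMr // ltrBrDl => elb; rewrite ltr0q in e0.
exists (fun k => q + e * k%:R) => [i j ij|k kl].
  by rewrite ltrD2l ltr_pM2l // ltr_nat.
rewrite rmorphD rmorphM rmorph_nat /=.
have e0' : 0 < ratr e :> R by rewrite ltr0q.
rewrite (lt_le_trans aq) /=; last first.
  by rewrite lerDl; apply: mulr_ge0 (ltW e0') (ler0n _ _).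
by apply: lt_trans elb; rewrite ltrD2l ltr_pM2l // ltr_nat.
Qed.

(** * A ramp sum outside the network family *)

Theorem lemma3 (R : realType) (a b : R) (hab : a < b) (W L l : nat)
    (hW : (1 <= W)%N) (hl : (num_params W L < l)%N) :
  ~ (CPwL a b l `<=` NNF a b W L).
Proof.
have [y yind] := exists_alg_independent R l.
have [u u_incr u_ab] := rat_progression_itvoo l hab.
have ru_incr : {homo (fun k => ratr (u k) : R) : i j / (i < j)%N >-> i < j}.
  by move=> i j ij; rewrite ltr_rat u_incr.
(* The counterexample: knots [u 0, ..., u (l - 1)] and independent slope changes [y]. *)
move=> /(_ _ (ramp_sum_CPwL y ru_incr (fun i il => u_ab i (ltnW il)))).
case=> N [NL NW gN].
move: hl; rewrite ltnNge => /negP; apply.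
apply: leq_trans (size_network_entries NL NW).
(* The generators are the entries of this particular network, so independence bounds [l] by their
   number, hence by [num_params W L]. *)
pose th (i : 'I_(size (network_entries N))) := (network_entries N)`_i.
apply: (@alg_independent_leq _ _ _ th y yind).
apply: (ramp_coef_rat_adjoin u_incr) => k /u_ab /andP[ak kb].
rewrite gN ?in_itv /= ?(ltW ak) ?(ltW kb) //.
apply: network_eval_rpred => [x /(nthP 0)[i iN <-]|j].
  exact: (rat_adjoin_gen th (Ordinal iN)).
by rewrite mxE rat_adjoin_rat.
Qed.
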